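(* Let $A\in\mathscr{B}(X)$. Assume that $\sup_{x\in A}\sum_{n=1}^{\infty}F^{2n}(x,A)<1$. Then for $0\le s\le1$ (and every $x\in X$), $$\bar F_{xA}(s)\le F^{(0)}_{xA}(s)+F^{(1)}_{xA}(s)\cdot\sup_{y\in A}F^{(1)}_{yA}(s)\cdot\Bigl[1-\sup_{y\in A}F^{(0)}_{yA}(s)\Bigr]^{-1}.$$
   Context: $\Phi=\{\Phi_n:n\in\mathbb{Z}_+\}$ is a discrete-time homogeneous Markov chain on a general state space $X$ with countably generated $\sigma$-field $\mathscr{B}(X)$ and transition kernel $P$, which is $\pi$-irreducible for its (unique) invariant probability measure $\pi$ (if $\pi(B)>0$, there exists $n\in\mathbb{N}$ such that $P^n(x,B)>0$ for all $x\in X$) and reversible: $\pi(dx)P(x,dy)=\pi(dy)P(y,dx)$. $\mathbb{P}_x$ is the probability given $\Phi_0=x$. $\tau_A=\inf\{n\ge1:\Phi_n\in A\}$ and $F^n(x,A)=\mathbb{P}_x\{\tau_A=n\}$. Let $\bar\Phi_n=\Phi_{2n}$ be the two-skeleton chain, with transition kernel $P^2$, let $\bar\tau_A=\inf\{n\ge1:\bar\Phi_n\in A\}$ and $\bar F^n(x,A)=\mathbb{P}_x\{\bar\tau_A=n\}$. For $s\ge0$, $$\bar F_{xA}(s)=\sum_{n=1}^{\infty}s^{2n}\bar F^n(x,A),\quad F^{(0)}_{xA}(s)=\sum_{n=1}^{\infty}s^{2n}F^{2n}(x,A),\quad F^{(1)}_{xA}(s)=\sum_{n=1}^{\infty}s^{2n-1}F^{2n-1}(x,A).$$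 *)

(* Defs.v *)
From HB Require Import structures.
From mathcomp Require Import all_boot all_order all_algebra.
From mathcomp Require Import all_classical all_reals all_analysis.

Set Implicit Arguments.
Unset Strict Implicit.
Unset Printing Implicit Defensive.

Import Order.TTheory GRing.Theory Num.Theory.
Import numFieldNormedType.Exports.

Local Open Scope classical_set_scope.
Local Open Scope ring_scope.
Local Open Scope ereal_scope.

Definition countably_generated (d : measure_display) (X : measurableType d) :=
  exists G : set (set X), countable G /\ @measurable d X = <<s G >>.

Section kernels.
Context (d : measure_display) (X : measurableType d) (R : realType).
Variable P : R.-pker X ~> X.

Fixpoint kernel_iter (n : nat) (x : X) (B : set X) : \bar R :=
  if n is m.+1 then \int[P x]_y kernel_iter m y B else \d_x B.

Definition invariant_measure (mu : probability X R) :=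
  forall B, measurable B -> \int[mu]_x P x B = mu B.

Definition is_unique_invariant (pi : probability X R) :=
  invariant_measure pi /\
  forall mu : probability X R, invariant_measure mu ->
    forall B, measurable B -> mu B = pi B.

Definition irreducible (pi : probability X R) :=
  forall B, measurable B -> 0 < pi B ->
    forall x, exists2 n : nat, (1 <= n)%N & 0 < kernel_iter n x B.

(* pi(dx)P(x,dy) = pi(dy)P(y,dx), evaluated on the rectangle B `*` C. *)
Definition reversible (pi : probability X R) :=
  forall B C, measurable B -> measurable C ->
    \int[pi]_(x in B) P x C = \int[pi]_(y in C) P y B.

End kernels.

Section chain.
Context (d d' : measure_display) (X : measurableType d)
  (Om : measurableType d') (R : realType).

Definition natural_filtration (Phi : nat -> Om -> X) (n : nat) : set (set Om) :=
  <<s \bigcup_(k in [set k | (k <= n)%N])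
        preimage_set_system [set: Om] (Phi k) measurable >>.

(* Singletons need not be measurable in X, so "Phi_0 = x under PP x" is
   expressed by the law of Phi_0 being the Dirac mass at x.
   [mc_markov] is PP x (Phi_{n+1} \in B | Phi_0, ..., Phi_n) = P (Phi_n, B) a.s.,
   with conditional probability written out by its defining property. *)
Record is_markov_chain (P : R.-pker X ~> X) (PP : X -> probability Om R)
    (Phi : nat -> Om -> X) : Prop := {
  mc_measurable : forall n, measurable_fun [set: Om] (Phi n) ;
  mc_init : forall x B, measurable B -> PP x (Phi 0%N @^-1` B) = \d_x B ;
  mc_markov : forall x n E B, natural_filtration Phi n E -> measurable B ->
    PP x (E `&` Phi n.+1 @^-1` B) = \int[PP x]_(w in E) P (Phi n w) B }.

Definition skeleton2 (Phi : nat -> Om -> X) : nat -> Om -> X :=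
  fun n => Phi (2 * n)%N.

(* Equal to +oo when A is never visited at a time n >= 1. *)
Definition return_time (Phi : nat -> Om -> X) (A : set X) (w : Om) : \bar R :=
  ereal_inf [set n%:R%:E | n in [set n : nat | (1 <= n)%N /\ A (Phi n w)]].

Definition return_prob (PP : X -> probability Om R) (Phi : nat -> Om -> X)
    (n : nat) (x : X) (A : set X) : \bar R :=
  PP x [set w | return_time Phi A w = n%:R%:E].

Variables (PP : X -> probability Om R) (Phi : nat -> Om -> X).

Definition Fbar_gen (A : set X) (s : R) (x : X) : \bar R :=
  \sum_(1 <= n <oo) (s ^+ (2 * n))%:E * return_prob PP (skeleton2 Phi) n x A.

Definition F0_gen (A : set X) (s : R) (x : X) : \bar R :=
  \sum_(1 <= n <oo) (s ^+ (2 * n))%:E * return_prob PP Phi (2 * n) x A.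

Definition F1_gen (A : set X) (s : R) (x : X) : \bar R :=
  \sum_(1 <= n <oo)
    (s ^+ (2 * n - 1))%:E * return_prob PP Phi (2 * n - 1) x A.

End chain.

(* Main.v *)
(* Let o_n and e_n be the probabilities that the first visit to A at an odd,
   resp. even, time happens at time 2n+1, resp. 2n+2. The strong Markov
   property is not needed: by the simple Markov property, conditioning on the
   first step expresses the truncated generating functions O_N, E_N of
   (o_n), (e_n), and the truncations FO_N, FE_N of F^(1), F^(0), through one
   another. With c = sup_A F^(1) / (1 - sup_A F^(0)), a simultaneous induction
   on N then gives
     O_N <= FO_N + c FE_N   and   E_N <= FE_N + c FO_{N+1}   on X,
   the choice of c entering as FO_N + c FE_N <= c on A, which bounds O_N by c
   there. Letting N go to infinity in the second inequality is the claim. *)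
Require Import Defs.
From HB Require Import structures.
From mathcomp Require Import all_boot all_order all_algebra.
From mathcomp Require Import all_classical all_reals all_analysis.
From mathcomp Require Import measurable_realfun giry ring.

Set Implicit Arguments.
Unset Strict Implicit.
Unset Printing Implicit Defensive.

Import Order.TTheory GRing.Theory Num.Theory.
Import numFieldNormedType.Exports.

Local Open Scope classical_set_scope.
Local Open Scope ring_scope.
Local Open Scope ereal_scope.

(** * Integration along one step of a kernel, through the Giry monad *)

Section subprob.
Context (d : measure_display) (T : measurableType d) (R : realType).

(** A copy of [m] indexed by its mass bound, so that a subprobability structure can be attached and
    [m] read as a point of [giry T R]. *)
Definition subprob (m : {measure set T -> \bar R}) of m [set: T] <= 1 :
  set T -> \bar R := m.

Variables (m : {measure set T -> \bar R}) (m1 : m [set: T] <= 1).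

HB.instance Definition _ := Measure.on (subprob m1).
HB.instance Definition _ :=
  Measure_isSubProbability.Build _ T R (subprob m1) m1.

End subprob.

Section kernel_mixture.
Context (d d' : measure_display) (T : measurableType d) (X : measurableType d')
  (R : realType).

Lemma ge0_integral_mrestr (mu : {measure set T -> \bar R}) (E : set T)
    (mE : measurable E) (h : T -> \bar R) :
  measurable_fun [set: T] h -> (forall w, 0 <= h w) ->
  \int[mrestr mu mE]_w h w = \int[mu]_(w in E) h w.
Proof.
move=> mh h0.
rewrite (@ge0_negligible_integral _ _ _ _ setT (~` E))//; last 2 first.
- exact: measurableC.
- by rewrite /= /mrestr setICl measure0.
rewrite setDE setCK setTI; apply: eq_measure_integral => B mB BE.
by rewrite /= /mrestr setIidl.
Qed.

(** Extends the one-step Markov identity from sets [B] to nonnegative integrands [h]; the hypothesis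
    on [mu] has the shape of [mc_markov]. *)
Lemma ge0_integral_kernel_mixture (P : R.-pker X ~> X) (mu : probability T R)
    (E : set T) (f g : T -> X) (h : X -> \bar R) :
  measurable E -> measurable_fun [set: T] f -> measurable_fun [set: T] g ->
  (forall B, measurable B ->
    mu (E `&` g @^-1` B) = \int[mu]_(w in E) P (f w) B) ->
  measurable_fun [set: X] h -> (forall y, 0 <= h y) ->
  \int[mu]_(w in E) h (g w) = \int[mu]_(w in E) \int[P (f w)]_y h y.
Proof.
move=> mE mf mg mugE mh h0.
(* The law of [g] under [mu] restricted to [E] is the Giry bind of that
   restriction with [P \o f]. *)
have P1 w : P (f w) [set: X] <= 1 by rewrite prob_kernel.
pose K w : giry X R := subprob (P1 w).
have mK : measurable_fun [set: T] K.
  apply: measurable_giry_codensity => // B mB.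
  exact: measurableT_comp (measurable_kernel P B mB) mf.
have M1 : mrestr mu mE [set: T] <= 1.
  by rewrite /= /mrestr setTI; exact: probability_le1.
pose M : giry T R := subprob M1.
have mPh : measurable_fun [set: T] (fun w => \int[P (f w)]_y h y).
  apply: (@measurableT_comp _ _ _ _ _ _ (fun x => \int[P x]_y h y)) => //.
  by apply: measurable_fun_integral_kernel => //; exact: measurable_kernel.
have := giry_int_bind M mK mh h0; rewrite /giry_int.
rewrite [RHS]ge0_integral_mrestr//; last by move=> w; exact: integral_ge0.
move=> <-.
rewrite -(@ge0_integral_mrestr mu E mE (h \o g))//; first last.
- by move=> w; exact: h0.
- exact: measurableT_comp mh mg.
rewrite -[LHS](@ge0_integral_pushforward _ _ _ _ _ g mg M setT h)//.
apply: eq_measure_integral => B mB _.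
rewrite /= /pushforward /giry_int ge0_integral_pushforward//; last first.
  exact: measurable_giry_ev.
rewrite [RHS]ge0_integral_mrestr//; last first.
  by apply: (measurableT_comp _ mK); exact: measurable_giry_ev.
by rewrite /= /mrestr setIC mugE.
Qed.

End kernel_mixture.

(** * Laws of finite paths under the simple Markov property *)

Section markov.
Context (d d' : measure_display) (X : measurableType d)
  (Om : measurableType d') (R : realType).
Variables (P : R.-pker X ~> X) (PP : X -> probability Om R)
  (Phi : nat -> Om -> X) (hPhi : is_markov_chain P PP Phi).

Lemma natural_filtrationT n : natural_filtration Phi n setT.
Proof. exact: (@measurableT _ (g_sigma_algebraType _)). Qed.

Lemma natural_filtration_measurable n E :
  natural_filtration Phi n E -> measurable E.
Proof.
apply: smallest_sub; first exact: sigma_algebra_measurable.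
move=> _ [k _ [B mB <-]].
exact: (mc_measurable hPhi).
Qed.

Lemma natural_filtrationS n E B : natural_filtration Phi n E -> measurable B ->
  natural_filtration Phi n.+1 (E `&` Phi n.+1 @^-1` B).
Proof.
move=> nE mB; apply: (@measurableI _ (g_sigma_algebraType _)).
  apply: sub_sigma_algebra2 nE; apply: bigcup_subset => k /=.
  exact: leqW.
by apply: sub_sigma_algebra; exists n.+1 => //=; exists B; rewrite ?setTI.
Qed.

Fixpoint path_prob (l : seq (set X)) (x : X) : \bar R :=
  if l is B :: l' then \int[P x]_(y in B) path_prob l' y else 1.

Fixpoint path_event (n : nat) (l : seq (set X)) : set Om :=
  if l is B :: l' then Phi n.+1 @^-1` B `&` path_event n.+1 l' else setT.

Lemma path_prob_ge0 l x : 0 <= path_prob l x.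
Proof. by elim: l x => [|B l ih] x //=; exact: integral_ge0. Qed.

Fixpoint all_measurable (l : seq (set X)) : Prop :=
  if l is B :: l' then measurable B /\ all_measurable l' else True.

Lemma measurable_path_prob l : all_measurable l ->
  measurable_fun [set: X] (path_prob l).
Proof.
elim: l => [_|B l ih /= [mB /ih ml]]; first exact: measurable_cst.
under eq_fun do rewrite integral_mkcond.
apply: measurable_fun_integral_kernel.
- exact: measurable_kernel.
- by apply: erestrict_ge0 => y _; exact: path_prob_ge0.
- apply/(measurable_restrictT _ _).1 => //.
  exact: measurable_funS ml.
Qed.

(** Induction on [l] with [n] and [E] general: the first constraint of the list is absorbed into
    [E], which then belongs to the filtration at time [n.+1]. *)
Lemma path_event_cond (x : X) l n E : all_measurable l ->
  natural_filtration Phi n E ->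
  PP x (E `&` path_event n l) = \int[PP x]_(w in E) path_prob l (Phi n w).
Proof.
elim: l n E => [|B l ih] n E /=.
  move=> _ nE; have mE := natural_filtration_measurable nE.
  by rewrite setIT integral_cst// mul1e.
move=> [mB ml] nE; have mE := natural_filtration_measurable nE.
have mPhi k : measurable_fun [set: Om] (Phi k) := mc_measurable hPhi k.
have ml' := measurable_path_prob ml.
have mlB : measurable_fun [set: X] (path_prob l \_ B).
  by apply/(measurable_restrictT _ _).1 => //; exact: measurable_funS ml'.
rewrite setIA (ih n.+1)//; last exact: natural_filtrationS.
(* The constraint [B] moves from the event to the integrand, so that the one-step identity applies
   to [path_prob l \_ B]. *)
rewrite integral_mkcondr.
under [RHS]eq_integral do rewrite integral_mkcond.
rewrite -(@ge0_integral_kernel_mixture _ _ _ _ _ P (PP x) E (Phi n) (Phi n.+1)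
  (path_prob l \_ B))//.
- by move=> C mC; exact: mc_markov hPhi _ _ _ _ nE mC.
- by apply: erestrict_ge0 => y _; exact: path_prob_ge0.
Qed.

Lemma path_eventE (x : X) l : all_measurable l ->
  PP x (path_event 0 l) = path_prob l x.
Proof.
move=> ml; rewrite -[path_event _ _]setTI path_event_cond//; last first.
  exact: natural_filtrationT.
have mPhi0 : measurable_fun [set: Om] (Phi 0%N) := mc_measurable hPhi 0%N.
have mpl := measurable_path_prob ml.
rewrite -(@ge0_integral_pushforward _ _ _ _ _ _ mPhi0 (PP x) setT)//; last first.
  by move=> y _; exact: path_prob_ge0.
rewrite (@eq_measure_integral _ _ _ _ (\d_x))/=; last first.
  by move=> B mB _; exact: mc_init hPhi _ _ mB.
by rewrite integral_dirac// diracT mul1e.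
Qed.

End markov.

(** * First visits to [A] as path events, for the chain and its two-skeleton *)

Section first_visit.
Context (d d' : measure_display) (X : measurableType d)
  (Om : measurableType d') (R : realType).
Implicit Types (A : set X) (Phi : nat -> Om -> X).

(* The lists of [first_visit A n] and [first_odd_visit A n] describe a first
   visit to [A] at time [n + 1], resp. at time [2n + 1] among the odd times;
   prepending [setT] to the latter shifts it to time [2n + 2] among the even
   times. *)
Definition first_visit A (n : nat) : seq (set X) := rcons (nseq n (~` A)) A.

Fixpoint first_odd_visit A (n : nat) : seq (set X) :=
  if n is m.+1 then ~` A :: setT :: first_odd_visit A m else [:: A].

Lemma path_event_first_visitP Phi A n k w :
  path_event Phi k (first_visit A n) w <->
  A (Phi (k + n).+1 w) /\ forall i, (i < n)%N -> ~ A (Phi (k + i).+1 w).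
Proof.
elim: n k => [|n ih] k /=.
  by rewrite addn0; split=> [[]|[]].
split=> [[nA /ih[An nAi]]|[An nAi]].
  split=> [|[|i] /=]; rewrite ?addn0 -?addSnnS//.
  by rewrite ltnS; exact: nAi.
split; first by have := nAi 0%N; rewrite addn0; exact.
apply/ih; rewrite addSnnS; split=> // i ni.
by rewrite addSnnS; exact: nAi.
Qed.

Lemma return_timeP Phi A n w :
  return_time R Phi A w = n.+1%:R%:E <->
  A (Phi n.+1 w) /\ forall i, (i < n)%N -> ~ A (Phi i.+1 w).
Proof.
rewrite /return_time; set S := [set _ | _ in _].
split=> [Sn|[An nA]].
  have lbS k : A (Phi k.+1 w) -> (n <= k)%N.
    move=> Ak; rewrite -ltnS -(@ler_nat R) -lee_fin -Sn.
    by apply: ereal_inf_lbound; exists k.+1.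
  split=> [|i ni Ai]; last by have := lbS _ Ai; rewrite leqNgt ni.
  apply: contrapT => nAn.
  (* Without a visit at time [n.+1], every visit comes at time [n.+2] or later, and the infimum is
     too large. *)
  suff : n.+2%:R%:E <= ereal_inf S by rewrite Sn lee_fin ler_nat ltnn.
  apply: le_ereal_inf_tmp => _ [[|k] [//= _ Ak] <-].
  rewrite lee_fin ler_nat !ltnS ltn_neqAle lbS// andbT.
  by apply/eqP => nk; apply: nAn; rewrite nk.
apply/eqP; rewrite eq_le; apply/andP; split.
  by apply: ereal_inf_lbound; exists n.+1.
apply: le_ereal_inf_tmp => _ [[|k] [//= _ Ak] <-].
rewrite lee_fin ler_nat ltnS leqNgt; apply/negP => kn.
exact: nA kn Ak.
Qed.

Lemma path_event_return_time Phi A n :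
  [set w | return_time R Phi A w = n.+1%:R%:E] =
  path_event Phi 0 (first_visit A n).
Proof.
apply/seteqP; split=> w /=.
  by move/return_timeP => hw; exact/(path_event_first_visitP Phi A n 0).
by move/(path_event_first_visitP Phi A n 0) => hw; exact/return_timeP.
Qed.

(** One skeleton step is two steps of the chain, with no constraint at the time in between; hence
    the interleaved [setT]. *)
Lemma path_event_skeleton2 Phi A n k :
  path_event (skeleton2 Phi) k (first_visit A n) =
  path_event Phi (2 * k) (setT :: first_odd_visit A n).
Proof.
elim: n k => [|n ih] k /=.
  by rewrite preimage_setT setTI /skeleton2 mulnS.
by rewrite ih /= preimage_setT !setTI /skeleton2 mulnS.
Qed.

Lemma all_measurable_first_visit A n : measurable A ->
  all_measurable (first_visit A n).
Proof. by move=> mA; elim: n => //= n ih; split=> //; exact: measurableC. Qed.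

Lemma all_measurable_first_odd_visit A n : measurable A ->
  all_measurable (first_odd_visit A n).
Proof. by move=> mA; elim: n => //= n ih; split=> //; exact: measurableC. Qed.

Variables (P : R.-pker X ~> X) (PP : X -> probability Om R)
  (Phi : nat -> Om -> X) (hPhi : is_markov_chain P PP Phi).

Lemma return_prob_path_prob A n x : measurable A ->
  return_prob PP Phi n.+1 x A = path_prob P (first_visit A n) x.
Proof.
move=> mA; rewrite /return_prob path_event_return_time (path_eventE hPhi)//.
exact: all_measurable_first_visit.
Qed.

Lemma return_prob_skeleton2 A n x : measurable A ->
  return_prob PP (skeleton2 Phi) n.+1 x A =
  path_prob P (setT :: first_odd_visit A n) x.
Proof.
move=> mA; rewrite /return_prob path_event_return_time path_event_skeleton2.
rewrite muln0 (path_eventE hPhi)//; split=> //.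
exact: all_measurable_first_odd_visit.
Qed.

End first_visit.

(** * Truncated generating functions and their first-step recursions *)

Section generating_functions.
Context (d : measure_display) (X : measurableType d) (R : realType).
Variables (P : R.-pker X ~> X) (s : R).
Hypothesis s0 : (0 <= s)%R.
Implicit Types (A B : set X) (L : nat -> seq (set X)).

(** The length of [L n] is the time of its last constraint, hence the exponent of [s]. *)
Definition path_gf L (N : nat) (x : X) : \bar R :=
  \sum_(0 <= n < N) (s ^+ size (L n))%:E * path_prob P (L n) x.

Let term_ge0 l x : 0 <= (s ^+ size l)%:E * path_prob P l x.
Proof. by rewrite mule_ge0 ?path_prob_ge0// lee_fin exprn_ge0. Qed.

Lemma path_gf_ge0 L N x : 0 <= path_gf L N x.
Proof. by apply: sume_ge0 => n _; exact: term_ge0. Qed.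

Let measurable_term l : all_measurable l ->
  measurable_fun [set: X] (fun x => (s ^+ size l)%:E * path_prob P l x).
Proof. by move=> ml; apply: measurable_funeM; exact: measurable_path_prob. Qed.

Lemma measurable_path_gf L N : (forall n, all_measurable (L n)) ->
  measurable_fun [set: X] (path_gf L N).
Proof.
by move=> mL; apply: emeasurable_sum => n; exact: measurable_term.
Qed.

(** First-step analysis: an extra leading constraint costs one factor [s] and one integration
    against [P x]. *)
Lemma path_gf_cons B L N x : measurable B -> (forall n, all_measurable (L n)) ->
  path_gf (fun n => B :: L n) N x =
  s%:E * \int[P x]_(y in B) path_gf L N y.
Proof.
move=> mB mL; rewrite ge0_integral_sum//; last first.
  by move=> n; exact: measurable_funTS (measurable_term (mL n)).
rewrite ge0_sume_distrr; last first.
  by move=> n _; apply: integral_ge0 => y _; exact: term_ge0.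
apply: eq_bigr => n _ /=.
rewrite ge0_integralZl//; last 3 first.
- exact: measurable_funTS (measurable_path_prob P (mL n)).
- by move=> y _; exact: path_prob_ge0.
- by rewrite lee_fin exprn_ge0.
by rewrite exprS EFinM muleA.
Qed.

Lemma path_gf_recl L N x : path_gf L N.+1 x =
  (s ^+ size (L 0%N))%:E * path_prob P (L 0%N) x
  + path_gf (fun n => L n.+1) N x.
Proof. by rewrite /path_gf big_nat_recl. Qed.

Variables (A : set X) (c : \bar R).
Hypotheses (mA : measurable A) (c0 : 0 <= c).

(** [FO] and [FE] truncate F^(1) and F^(0), with first visits at times 2n+1 and 2n+2; [E] truncates
    the series of the skeleton, and [O] is its companion over odd times. *)
Let FO := path_gf (fun n => first_visit A n.*2).
Let FE := path_gf (fun n => first_visit A n.*2.+1).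
Let O := path_gf (first_odd_visit A).
Let E := path_gf (fun n => setT :: first_odd_visit A n).

Let mFO N : measurable_fun [set: X] (FO N).
Proof.
by apply: measurable_path_gf => n; exact: all_measurable_first_visit.
Qed.

Let mFE N : measurable_fun [set: X] (FE N).
Proof.
by apply: measurable_path_gf => n; exact: all_measurable_first_visit.
Qed.

Let mO N : measurable_fun [set: X] (O N).
Proof.
by apply: measurable_path_gf => n; exact: all_measurable_first_odd_visit.
Qed.

Let mE N : measurable_fun [set: X] (E N).
Proof.
by apply: measurable_path_gf => n; split=> //;
  exact: all_measurable_first_odd_visit.
Qed.

Let mAC : measurable (~` A). Proof. exact: measurableC. Qed.

Hypothesis cA : forall N y, A y -> FO N y + c * FE N y <= c.

(** Carries a bound through one step of the chain into [B]; nonnegativity keeps the arithmetic valid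
    when [c] is infinite. *)
Let integral_leD B f g h x : measurable B ->
  measurable_fun [set: X] f -> measurable_fun [set: X] g ->
  measurable_fun [set: X] h ->
  (forall y, 0 <= f y) -> (forall y, 0 <= g y) -> (forall y, 0 <= h y) ->
  (forall y, B y -> f y <= g y + c * h y) ->
  s%:E * \int[P x]_(y in B) f y <= s%:E * \int[P x]_(y in B) g y
    + c * (s%:E * \int[P x]_(y in B) h y).
Proof.
move=> mB mf mg mh f0 g0 h0 fgh.
rewrite muleCA -ge0_muleDr ?integral_ge0//; last first.
  by rewrite mule_ge0// integral_ge0.
apply: lee_wpmul2l; first by rewrite lee_fin.
have mS (k : X -> \bar R) : measurable_fun [set: X] k -> measurable_fun B k.
  by move=> mk; exact: measurable_funTS mk.
have mch : measurable_fun [set: X] (fun y => c * h y).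
  exact: measurable_funeM.
rewrite -ge0_integralZl//; last exact: mS.
rewrite -ge0_integralD//; last 3 first.
- exact: mS.
- by move=> y _; exact: mule_ge0.
- exact: mS.
apply: ge0_le_integral => //; first exact: mS.
by apply: mS; exact: emeasurable_funD.
Qed.

(** A first visit at an odd time either occurs at time 1 or is a step outside [A] followed by a
    first visit at an even time. *)
Let path_gfA N x : FO N.+1 x = s%:E * \int[P x]_(y in A) 1 +
  s%:E * \int[P x]_(y in ~` A) FE N y.
Proof.
rewrite /FO path_gf_recl /= expr1; congr (_ + _).
apply: (@path_gf_cons (~` A) (fun n => first_visit A n.*2.+1)) => // n.
exact: all_measurable_first_visit.
Qed.

Lemma path_gf_even_odd_le N x :
  O N x <= FO N x + c * FE N x /\ E N x <= FE N x + c * FO N.+1 x.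
Proof.
have FO0 k y : 0 <= FO k y by exact: path_gf_ge0.
have FE0 k y : 0 <= FE k y by exact: path_gf_ge0.
have O0 k y : 0 <= O k y by exact: path_gf_ge0.
have E0 k y : 0 <= E k y by exact: path_gf_ge0.
have sint0 B (f : X -> \bar R) y :
    (forall z, 0 <= f z) -> 0 <= s%:E * \int[P y]_(z in B) f z.
  by move=> f0; rewrite mule_ge0 ?lee_fin// integral_ge0.
have FEE k y : FE k y = s%:E * \int[P y]_(z in ~` A) FO k z.
  apply: (@path_gf_cons (~` A) (fun n => first_visit A n.*2)) => // n.
  exact: all_measurable_first_visit.
have OE k : (forall y, O k y <= FO k y + c * FE k y) ->
    forall y, E k y <= FE k y + c * FO k.+1 y.
  move=> OFO y; rewrite /E path_gf_cons//; last first.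
    by move=> n; exact: all_measurable_first_odd_visit.
  (* The unconstrained first step is split on [A]. Inside, [O k] is at most [c], which gives [c]
     times the time-1 term of [FO k.+1]; outside, the integrated bound gives [FE k] and the rest of
     [c * FO k.+1]. *)
  rewrite -(setUv A) ge0_integral_setU//; last 2 first.
  - exact: measurable_funTS.
  - exact/disj_setPCl.
  rewrite ge0_muleDr ?integral_ge0// path_gfA [c * _]ge0_muleDr ?sint0//.
  rewrite FEE addeCA; apply: leeD.
    rewrite muleCA; apply: lee_wpmul2l; first by rewrite lee_fin.
    rewrite -ge0_integralZl//.
    apply: ge0_le_integral => //; [exact: measurable_funTS|].
    by move=> z Az; rewrite mule1; exact: le_trans (OFO z) (cA _ Az).
  exact: integral_leD.
suff OFO k : forall y, O k y <= FO k y + c * FE k y.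
  by split; [exact: OFO|exact/OE/OFO].
elim: k => [|k ih] y.
  by rewrite /O /path_gf big_nil adde_ge0// mule_ge0.
(* The time-1 terms agree. The rest is a step outside [A] followed by [E k], and integrating the
   bound from [OE] gives the tail of [FO k.+1] plus [c * FE k.+1]. *)
rewrite /O path_gf_recl /= expr1 path_gfA -addeA; apply: leeD => //.
rewrite FEE (@path_gf_cons _ (fun n => setT :: first_odd_visit A n))//.
  by apply: integral_leD => // z _; exact: OE.
by move=> n; split=> //; exact: all_measurable_first_odd_visit.
Qed.
End generating_functions.

(** * Comparison of the truncations with the full series *)

Section return_time_series.
Context (d d' : measure_display) (X : measurableType d)
  (Om : measurableType d') (R : realType).
Variables (P : R.-pker X ~> X) (PP : X -> probability Om R)
  (Phi : nat -> Om -> X) (hPhi : is_markov_chain P PP Phi).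
Variables (A : set X) (s : R).
Hypotheses (mA : measurable A) (s0 : (0 <= s)%R).

Lemma return_prob_ge0 (Psi : nat -> Om -> X) n x :
  0 <= return_prob PP Psi n x A.
Proof. exact: measure_ge0. Qed.

Let term_ge0 (Psi : nat -> Om -> X) k n x :
  0 <= (s ^+ k)%:E * return_prob PP Psi n x A.
Proof. by rewrite mule_ge0 ?return_prob_ge0// lee_fin exprn_ge0. Qed.

Lemma size_first_visit n : size (first_visit A n) = n.+1.
Proof. by rewrite size_rcons size_nseq. Qed.

Lemma size_first_odd_visit n : size (first_odd_visit A n) = n.*2.+1.
Proof. by elim: n => //= n ->; rewrite doubleS. Qed.

Lemma path_gf_le_F0_gen N x :
  path_gf P s (fun n => first_visit A n.*2.+1) N x <= F0_gen PP Phi A s x.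
Proof.
(* The series starts at index 1, so its partial sum below [N.+1] has the [N] terms of the
   truncation. *)
rewrite /F0_gen; apply: le_trans (nneseries_lim_ge N.+1 _) => //.
rewrite big_add1 /=; apply: lee_sum => n _.
by rewrite size_first_visit mul2n doubleS (return_prob_path_prob hPhi).
Qed.

Lemma path_gf_le_F1_gen N x :
  path_gf P s (fun n => first_visit A n.*2) N x <= F1_gen PP Phi A s x.
Proof.
rewrite /F1_gen; apply: le_trans (nneseries_lim_ge N.+1 _) => //.
rewrite big_add1 /=; apply: lee_sum => n _.
by rewrite size_first_visit mul2n doubleS subn1 (return_prob_path_prob hPhi).
Qed.

Lemma Fbar_gen_le x (M : \bar R) :
  (forall N, path_gf P s (fun n => setT :: first_odd_visit A n) N x <= M) ->
  Fbar_gen PP Phi A s x <= M.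
Proof.
move=> gfM; apply: lime_le; first exact: is_cvg_nneseries.
apply: nearW => N; apply: le_trans (gfM N.-1).
rewrite big_add1; apply: lee_sum => n _.
rewrite (return_prob_skeleton2 hPhi)//= size_first_odd_visit.
by rewrite mul2n doubleS.
Qed.

Lemma F0_gen_ge0 x : 0 <= F0_gen PP Phi A s x.
Proof. exact: nneseries_ge0. Qed.

Lemma F1_gen_ge0 x : 0 <= F1_gen PP Phi A s x.
Proof. exact: nneseries_ge0. Qed.

(** Since s^(2n) <= 1, the assumption of the theorem, which is the case s = 1, controls every
    smaller [s]. *)
Lemma F0_gen_le x : (s <= 1)%R ->
  F0_gen PP Phi A s x <= \sum_(1 <= n <oo) return_prob PP Phi (2 * n) x A.
Proof.
move=> s1; apply: lee_nneseries => // n _.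
rewrite -[leRHS]mul1e; apply: lee_wpmul2r; first exact: return_prob_ge0.
by rewrite lee_fin exprn_ile1.
Qed.

End return_time_series.

(* The affine map [u |-> a + b * u] fixes [a / (1 - b)]. *)
Lemma le_adde_mule_divB (R : realType) (a b f g : \bar R) :
  0 <= a -> 0 <= b -> b < 1 -> f <= a -> 0 <= g <= b ->
  f + a * (1 - b)^-1 * g <= a * (1 - b)^-1.
Proof.
case: b => [b| |]//; rewrite lte_fin => a0 b0 b1 fa /andP[g0 gb].
have b1' : (0 < 1 - b)%R by rewrite subr_gt0.
rewrite -EFinB inver gt_eqF//.
case: a a0 fa => [a| |]// a0 fa; last first.
  (* For infinite [a] the right-hand side is infinite, because 1 / (1 - b) is positive. *)
  by rewrite gt0_mulye ?lte_fin ?invr_gt0// leey.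
apply: (@le_trans _ _ (a%:E + a%:E * ((1 - b)^-1)%R%:E * b%:E)).
  apply: leeD => //; apply: lee_wpmul2l => //.
  by rewrite mule_ge0// lee_fin invr_ge0 ltW.
rewrite -!EFinM -EFinD lee_fin le_eqVlt; apply/orP; left; apply/eqP.
by field; rewrite gt_eqF.
Qed.

(** * Choice of the constant from the suprema over [A] *)

Theorem lemma4p1 (R : realType) (d d' : measure_display)
  (X : measurableType d) (Om : measurableType d')
  (P : R.-pker X ~> X) (pi : probability X R)
  (PP : X -> probability Om R) (Phi : nat -> Om -> X)
  (hX : countably_generated X)
  (hPhi : is_markov_chain P PP Phi)
  (hinv : is_unique_invariant P pi)
  (hirr : irreducible P pi)
  (hrev : reversible P pi)
  (A : set X) (hA : measurable A)
  (hsup : ereal_sup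
    [set \sum_(1 <= n <oo) return_prob PP Phi (2 * n) x A | x in A] < 1)
  (s : R) (hs0 : (0 <= s)%R) (hs1 : (s <= 1)%R) (x : X) :
  Fbar_gen PP Phi A s x <=
    F0_gen PP Phi A s x
    + F1_gen PP Phi A s x
      * ereal_sup [set F1_gen PP Phi A s y | y in A]
      * (1 - ereal_sup [set F0_gen PP Phi A s y | y in A])^-1.
Proof.
set S1 := ereal_sup [set F1_gen PP Phi A s y | y in A].
set S0 := ereal_sup [set F0_gen PP Phi A s y | y in A].
have F0S0 y : A y -> F0_gen PP Phi A s y <= S0.
  by move=> Ay; apply: ereal_sup_ubound; exists y.
have F1S1 y : A y -> F1_gen PP Phi A s y <= S1.
  by move=> Ay; apply: ereal_sup_ubound; exists y.
have S0lt1 : S0 < 1.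
  apply: le_lt_trans hsup; apply: ge_ereal_sup => _ [y Ay <-].
  apply: le_trans (F0_gen_le _ _ _ hs0 y hs1) _.
  by apply: ereal_sup_ubound; exists y.
(* On the empty set both suprema are [-oo] and the last factor is [0]. *)
pose c := if pselect (A !=set0) then S1 * (1 - S0)^-1 else 0.
have cE : F1_gen PP Phi A s x * S1 * (1 - S0)^-1 = c * F1_gen PP Phi A s x.
  rewrite /c; case: pselect => [?|A0]; first by rewrite -muleA muleC.
  suff -> : S0 = -oo by rewrite /= invey mule0 mul0e.
  by rewrite /S0 (_ : A = set0) ?image_set0 ?ereal_sup0//; exact/nonemptyPn.
have S_ge0 y : A y -> 0 <= S0 /\ 0 <= S1.
  move=> Ay; split.
    exact: le_trans (F0_gen_ge0 _ _ _ hs0 y) (F0S0 _ Ay).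
  exact: le_trans (F1_gen_ge0 _ _ _ hs0 y) (F1S1 _ Ay).
have c0 : 0 <= c.
  rewrite /c; case: pselect => // -[y Ay]; have [S00 S10] := S_ge0 _ Ay.
  by rewrite mule_ge0// inve_ge0 sube_ge0 ?orbT// ltW.
rewrite cE; apply: (Fbar_gen_le hPhi) => // N.
(* The condition on [c] is vacuous for empty [A]; otherwise it is the fixed-point inequality with a
   = [S1] and b = [S0]. *)
have [|_] := @path_gf_even_odd_le _ _ _ P s hs0 A c hA c0 _ N x.
  move=> {}N y Ay; have [S00 S10] := S_ge0 _ Ay.
  rewrite /c; case: pselect => [?|[]]; last by exists y.
  apply: le_adde_mule_divB => //.
    exact: le_trans (path_gf_le_F1_gen hPhi hA hs0 N y) (F1S1 _ Ay).
  rewrite path_gf_ge0//=.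
  exact: le_trans (path_gf_le_F0_gen hPhi hA hs0 N y) (F0S0 _ Ay).
move=> /le_trans; apply; apply: leeD; first exact: path_gf_le_F0_gen.
by apply: lee_wpmul2l => //; exact: path_gf_le_F1_gen.
Qed.
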